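(* There exists a set $\mathcal{L}$ of positive integers with the following two properties. (i) For every Lucas sequence $\{u_n\}_{n\ge 0}$ with $a_2=\pm1$ (that is, $u_0=0$, $u_1=1$, $u_{n+2}=a_1u_{n+1}+a_2u_n$ with $a_1\in\mathbb{Z}$, $a_2\in\{1,-1\}$, whose characteristic polynomial $X^2-a_1X-a_2$ has distinct roots $\alpha_1,\alpha_2$ with $\alpha_1/\alpha_2$ not a root of unity), we have $\mathcal{L}\subseteq\{n\ge1: n\mid u_n\}$. (ii) If for some fixed real $v>1$ one has $\Pi(y^v,y)\ge y^{v+o(1)}$ as $y\to\infty$, then $$\#(\mathcal{L}\cap[1,x])\ge x^{1-1/v+o(1)}\qquad\text{as }x\to\infty.$$ Consequently, under this hypothesis, $\#\{n\le x: n\mid u_n\}\ge x^{1-1/v+o(1)}$ for every such Lucas sequence.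
   Context: For real $x\ge y\ge 2$, $\Pi(x,y)$ denotes the number of primes $p\le x$ such that $p^2-1$ is $y$-smooth, i.e. has no prime divisor exceeding $y$. *)

(* Defs.v *)
From HB Require Import structures.
From mathcomp Require Import all_boot all_order all_algebra all_field finmap.
From mathcomp Require Import all_classical all_reals all_analysis.
Set Implicit Arguments.
Unset Strict Implicit.
Unset Printing Implicit Defensive.
Import Order.TTheory GRing.Theory Num.Theory.
Import numFieldNormedType.Exports.
Local Open Scope classical_set_scope.
Local Open Scope ring_scope.

Definition lucas_char_poly (a1 a2 : int) : {poly algC} :=
  'X^2 - (a1%:~R)%:P * 'X - (a2%:~R)%:P.

(* [0.-unity_root] holds of everything, hence the guard [0 < m]. *)
Definition lucas_nondegenerate (a1 a2 : int) : Prop :=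
  exists alpha1 alpha2 : algC,
    [/\ lucas_char_poly a1 a2 = ('X - alpha1%:P) * ('X - alpha2%:P),
        alpha1 != alpha2 &
        forall m : nat, (0 < m)%N -> ~~ m.-unity_root (alpha1 / alpha2)].

Definition lucas_sequence (a1 a2 : int) (u : nat -> int) : Prop :=
  [/\ u 0%N = 0, u 1%N = 1,
      forall n : nat, u n.+2 = a1 * u n.+1 + a2 * u n &
      lucas_nondegenerate a1 a2].

Definition self_divisors (u : nat -> int) : set nat :=
  [set n : nat | (0 < n)%N /\ (n%:Z %| u n)%Z].

Definition smooth (R : realType) (y : R) (m : nat) : Prop :=
  forall q : nat, prime q -> (q %| m)%N -> q%:R <= y.

(* [fset_set] returns the empty set on infinite sets, but [A `&` [set n | ...]]
   is always finite. *)
Definition count_upto (R : realType) (A : set nat) (x : R) : nat :=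
  #|` fset_set (A `&` [set n : nat | (1 <= n)%N /\ n%:R <= x])|.

Definition Pi_smooth (R : realType) (x y : R) : nat :=
  count_upto [set p : nat | prime p /\ smooth y (p ^ 2 - 1)%N] x.

(* F(x) >= x^(c + o(1)) as x tends to infinity *)
Definition ge_power_o1 (R : realType) (F : R -> nat) (c : R) : Prop :=
  exists eps : R -> R,
    eps x @[x --> +oo] --> (0 : R) /\
    \forall x \near +oo, x `^ (c + eps x) <= (F x)%:R.

(* Main.v *)
Require Import Defs.
From HB Require Import structures.
From mathcomp Require Import all_boot all_order all_algebra all_field finmap.
From mathcomp Require Import all_classical all_reals all_analysis.
From mathcomp Require Import ring lra.
Set Implicit Arguments.
Unset Strict Implicit.
Unset Printing Implicit Defensive.
Import Order.TTheory GRing.Theory Num.Theory.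
Import numFieldNormedType.Exports.
Local Open Scope classical_set_scope.
Local Open Scope ring_scope.

(* Take for L the set of n >= 1 such that q^2 - 1 divides n for every prime q
   dividing n.  If a2 = 1 or -1, a prime q divides u_q or u_(q^2-1); as q | u_m
   implies q^(j+1) | u_(m q^j), every prime power exactly dividing n in L
   divides u_n.
   For the counting, fix a small d > 0 and write x = exp (y^(1+d)).  Let M be a
   y-smooth number, with log M = o(log x), divisible by all y-smooth numbers up
   to y^(2v).  Then M times any product of k distinct primes counted by
   Pi (y^v, y) is in L.  With k close to log x / (v log y) these products stay
   below x, and there are at least (Pi (y^v, y) / k)^k of them. *)

(** * Lucas sequences: divisibility by primes and prime powers *)

Lemma sqrn_sub1 q : (q ^ 2 - 1 = q.-1 * q.+1)%N.
Proof. by rewrite -[1%N](exp1n 2) subn_sqr subn1 addn1. Qed.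

Definition companion (R : nzRingType) (c d : R) : 'M[R]_2 :=
  \matrix_(i, j) if i == 0 then (if j == 0 then c else d)
                 else (if j == 0 then 1 else 0).

Lemma companion_sqr (R : comNzRingType) (c d : R) :
  companion c d ^+ 2 = c *: companion c d + d *: 1.
Proof.
apply/matrixP => i j; rewrite expr2 !mxE !big_ord_recl big_ord0 !mxE /=.
by case: i => [[|[|]]] //= ?; case: j => [[|[|]]] //= ?; rewrite ?mxE /=; ring.
Qed.

(** Along the recurrence this is [b * u n.-1] for n >= 1, and the subtractive form also gives the
    right value 1 at n = 0. With it, X^n = u_n X + t_n modulo X^2 - aX - b. *)
Definition lucas_shift (a : int) (u : nat -> int) (n : nat) : int :=
  u n.+1 - a * u n.

Section LucasRecurrence.

Variables (a b : int) (u : nat -> int).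
Hypothesis u0 : u 0%N = 0.
Hypothesis u1 : u 1%N = 1.
Hypothesis uSS : forall n, u n.+2 = a * u n.+1 + b * u n.

Local Notation t := (lucas_shift a u).

Lemma lucasS n : u n.+1 = a * u n + t n.
Proof. by rewrite /lucas_shift; ring. Qed.

Lemma lucas_shiftS n : t n.+1 = b * u n.
Proof. by rewrite /lucas_shift uSS; ring. Qed.

Lemma lucas_shift0 : t 0%N = 1.
Proof. by rewrite /lucas_shift u0 u1; ring. Qed.

(** Multiply u_m X + t_m by u_n X + t_n and reduce by X^2 = aX + b. *)
Lemma lucas_add m n :
  u (m + n)%N = a * u m * u n + u m * t n + t m * u n /\
  t (m + n)%N = b * u m * u n + t m * t n.
Proof.
elim: m => [|m [IHu IHt]]; first by rewrite add0n u0 lucas_shift0; split; ring.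
rewrite addSn !(lucasS, lucas_shiftS) IHu IHt.
by split; ring.
Qed.

Lemma lucas_dvd_mul m k : (u m %| u (m * k)%N)%Z.
Proof.
elim: k => [|k IHk]; first by rewrite muln0 u0 dvdz0.
rewrite mulnS (lucas_add _ _).1.
by do 2?apply: rpredD;
  [apply/dvdz_mulr/dvdz_mull | apply: dvdz_mulr | apply: dvdz_mull].
Qed.

Lemma lucas_dvd m n : (m %| n)%N -> (u m %| u n)%Z.
Proof. by case/dvdnP => k ->; rewrite mulnC lucas_dvd_mul. Qed.

(** Binomial expansion of (u_m X + t_m)^(k+1); the terms of degree at least 2 in u_m are collected
    in [c] and [d]. *)
Lemma lucas_mulS m k : exists c d : int,
  u (m * k.+1)%N = (k.+1)%:R * u m * t m ^+ k + u m ^+ 2 * c /\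
  t (m * k.+1)%N = t m ^+ k.+1 + u m ^+ 2 * d.
Proof.
elim: k => [|k [c [d [IHu IHt]]]].
  by exists 0, 0; rewrite muln1 expr1 expr0; split; ring.
rewrite mulnS !(lucas_add _ _).1 !(lucas_add _ _).2 IHu IHt.
exists (a * (k.+1%:R * t m ^+ k + u m * c) + u m * d + t m * c).
exists (b * (k.+1%:R * t m ^+ k + u m * c) + t m * d).
by rewrite !exprS -[in k.+2%:R]natr1; split; ring.
Qed.

(** Passing from index n to qn gains a factor q: modulo u_n^2, u_(qn) is q u_n t_n^(q-1), and q u_n
    divides u_n^2 because q divides u_n. *)
Lemma lucas_dvd_expS (q m j : nat) :
  (q%:Z %| u m)%Z -> ((q ^ j.+1)%N%:Z %| u (m * q ^ j)%N)%Z.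
Proof.
move=> qm; elim: j => [|j IHj]; first by rewrite expn1 muln1.
case: q qm IHj => [|q] qm IHj.
  by rewrite (exp0n (_ : 0 < j.+1)%N) // muln0 u0 dvdz0.
have qu : (q.+1%:Z %| u (m * q.+1 ^ j)%N)%Z.
  by apply: (dvdz_trans qm); apply: lucas_dvd_mul.
rewrite [(q.+1 ^ j.+1)%N]expnSr mulnA.
have [c [d [-> _]]] := lucas_mulS (m * q.+1 ^ j)%N q.
rewrite expnSr PoszM; apply: rpredD; last first.
  by rewrite expr2 dvdz_mulr // dvdz_mul.
rewrite dvdz_mulr // mulrC dvdz_mul // natz.
exact: dvdzz.
Qed.

(** By [companion_sqr] the matrix plays the part of X; over ['F_q] this makes the Frobenius map
    available. *)
Lemma companion_exp (R : comNzRingType) n :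
  let A := companion (a%:~R : R) b%:~R in
  A ^+ n = (u n)%:~R *: A + (t n)%:~R *: 1.
Proof.
move=> A; elim: n => [|n IHn].
  by rewrite u0 lucas_shift0 expr0 scale0r scale1r add0r.
rewrite exprSr IHn lucasS lucas_shiftS mulrDl -!scalerAl mul1r -expr2.
rewrite companion_sqr -/A (intrD _ (a * u n)) !intrM scalerDr !scalerA scalerDl.
by rewrite [_ * a%:~R]mulrC [_ * b%:~R]mulrC addrAC.
Qed.

Lemma Fp_two_neq0 q : prime q -> odd q -> (2 : 'F_q) != 0.
Proof.
move=> q_pr; apply: contraL; rewrite -(dvdn_pcharf (pchar_Fp q_pr)).
by rewrite dvdn_prime2 // => /eqP ->.
Qed.

(* With [A] the companion matrix over ['F_q] and [D = 2A - a], one has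
   [D ^ 2 = a ^ 2 + 4 b], while Frobenius gives [D ^ q = 2 A ^ q - a]. *)
Lemma lucas_prime_Frobenius q : prime q -> odd q ->
  let e : 'F_q := (a%:~R ^+ 2 + 4 * b%:~R) ^+ q./2 in
  (u q)%:~R = e /\ 2 * (t q)%:~R = a%:~R * (1 - e).
Proof.
move=> q_pr q_odd; set e := (_ ^+ _); set A := companion (a%:~R : 'F_q) b%:~R.
have Fq (x : 'F_q) : x ^+ q = x by rewrite -{2}(expf_card x) card_Fp.
have qM : q \in [pchar 'M['F_q]_2] by rewrite pchar_lalg pchar_Fp.
pose D := 2 *: A - a%:~R *: 1.
have DD : D ^+ 2 = (a%:~R ^+ 2 + 4 * b%:~R) *: 1.
  apply/matrixP => i j; rewrite expr2 !mxE !big_ord_recl big_ord0 !mxE /=.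
  by case: i => [[|[|]]] //= ?; case: j => [[|[|]]] //= ?;
    rewrite ?mxE /=; ring.
have Dq : D ^+ q = e *: D.
  have qE : q = (2 * q./2).+1 by rewrite mul2n -[LHS]odd_double_half q_odd.
  rewrite [X in D ^+ X]qE exprS exprM DD.
  by rewrite exprZn expr1n -scalerAr mulr1.
have /(pFrobenius_autB_comm qM) : GRing.comm (2 *: A) (a%:~R *: 1).
  by apply: GRing.commr_sym; apply: GRing.comm_alg.
rewrite !pFrobenius_autE -/D Dq !exprZn expr1n !Fq companion_exp -/A.
move=> /matrixP E; split.
  (* The bottom row of [A] is (1, 0), so its two entries separate u_q from t_q. *)
  have := E 1 0; rewrite !mxE /= !(mulr1, mulr0, addr0, subr0) mulrC.
  by move/(mulfI (Fp_two_neq0 q_pr q_odd)).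
have := E 1 1; rewrite !mxE /= !(mulr1, mulr0, add0r, sub0r) => H.
by rewrite mulrBr mulr1 -[2 * _](subrK a%:~R) -H mulrN [e * _]mulrC addrC.
Qed.

Lemma dvdz_Fp q (n : int) : prime q -> (q%:Z %| n)%Z = (n%:~R == 0 :> 'F_q).
Proof. by move=> q_pr; rewrite (dvdz_pcharf (pchar_Fp q_pr)). Qed.

(** For odd q, the e of [lucas_prime_Frobenius] is the Legendre symbol of the discriminant a^2 + 4b.
    Modulo q, u_q vanishes if e = 0, t_q = b u_(q-1) if e = 1, and u_(q+1) = a u_q + t_q if e = -1.
    Both q - 1 and q + 1 divide q^2 - 1. *)
Lemma lucas_prime_dvd q : prime q -> ~~ (q%:Z %| b)%Z ->
  (q%:Z %| u q)%Z \/ (q%:Z %| u (q ^ 2 - 1)%N)%Z.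
Proof.
move=> q_pr qb.
have [q2 | q_odd] := even_prime q_pr.
  (* Here b is odd: u_2 = a settles even a, and u_3 = a^2 + b settles odd a. *)
  rewrite q2 -[(2 ^ 2 - 1)%N]/3%N !uSS u1 u0 !mulr0 !addr0 !mulr1.
  move: qb; rewrite !dvdz_Fp ?q2 //.
  rewrite intrD intrM; move: (a%:~R : 'F_2) (b%:~R : 'F_2).
  case=> [[|[|]]] // ?; first by left.
  by case=> [[|[|]]] // ? _; right.
have [E1 E2] := lucas_prime_Frobenius q_pr q_odd.
move: E1 E2; set e := (_ ^+ _) => E1 E2.
have [D0 | D0] := eqVneq (a%:~R ^+ 2 + 4 * b%:~R : 'F_q) 0.
  by left; rewrite dvdz_Fp // E1 /e D0 expr0n eqn0Ngt half_gt0 prime_gt1.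
right.
have e2 : e ^+ 2 = 1.
  have qE' : ((q./2 * 2).+1 = q)%N by rewrite -[RHS]odd_double_half q_odd muln2.
  (* The discriminant times e^2 is its own q-th power, hence the discriminant again. *)
  apply: (mulfI D0); rewrite /e -exprM -exprS qE' mulr1.
  by rewrite -[X in _ ^+ X](card_Fp q_pr) expf_card.
move/eqP: e2; rewrite sqrf_eq1 => /orP[] /eqP e1.
  suff: (q%:Z %| u q.-1)%Z.
    by move/dvdz_trans; apply; rewrite sqrn_sub1; apply: lucas_dvd_mul.
  move: E2; rewrite e1 subrr mulr0 => /eqP.
  rewrite mulf_eq0 (negPf (Fp_two_neq0 q_pr q_odd)) /=.
  rewrite -[X in t X](prednK (prime_gt0 q_pr)) lucas_shiftS intrM mulf_eq0.
  by rewrite -!dvdz_Fp // (negPf qb).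
suff: (q%:Z %| u q.+1)%Z.
  by move/dvdz_trans; apply; rewrite sqrn_sub1 mulnC; apply: lucas_dvd_mul.
rewrite dvdz_Fp // lucasS (intrD _ (a * u q)) intrM E1 e1 mulrN1.
move: E2; rewrite e1 opprK mulrC => /(mulIf (Fp_two_neq0 q_pr q_odd)) ->.
by rewrite addNr.
Qed.

End LucasRecurrence.

(** * The set L and its inclusion in the self-divisors of Lucas sequences *)

Definition sqr_pred_closed : set nat :=
  [set n | (0 < n)%N /\ forall q, prime q -> (q %| n)%N -> (q ^ 2 - 1 %| n)%N].

Lemma sqr_pred_closed_lucas (a b : int) (u : nat -> int) (n : nat) :
  u 0%N = 0 -> u 1%N = 1 -> (forall n, u n.+2 = a * u n.+1 + b * u n) ->
  b = 1 \/ b = -1 -> sqr_pred_closed n -> (n%:Z %| u n)%Z.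
Proof.
move=> u0 u1 uSS b1 [n_gt0 nL]; rewrite dvdzE.
apply/dvdn_partP => // q; rewrite mem_primes => /and3P[q_pr _ qn].
have qb : ~~ (q%:Z %| b)%Z.
  by case: b1 => ->; rewrite dvdzE /= gtnNdvd // prime_gt1.
rewrite p_part -[(_ ^ _)%N]/`|(q ^ logn q n)%N%:Z|%N -dvdzE.
have [m qm nE] := pfactor_coprime q_pr n_gt0.
have [j jE] : exists j, logn q n = j.+1.
  by exists (logn q n).-1; rewrite prednK // logn_gt0 mem_primes q_pr n_gt0.
have [qq | qq] := lucas_prime_dvd u0 u1 uSS q_pr qb.
  rewrite jE; apply: dvdz_trans (lucas_dvd_expS u0 u1 uSS j qq) _.
  by apply: (lucas_dvd u0 u1 uSS); rewrite -expnS -jE {2}nE dvdn_mull.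
(* Since q^2 - 1 divides n = m q^(j+1) and is prime to q, it divides m. *)
have qS : (q ^ 2 - 1 %| m)%N.
  have := nL q q_pr qn; rewrite {1}nE Gauss_dvdl // coprimeXr //.
  have q2 : (0 < q ^ 2)%N by rewrite expn_gt0 prime_gt0.
  rewrite coprime_sym prime_coprime //; apply/negP => qd.
  have := dvdn_sub (dvdn_exp2l q (isT : (1 <= 2)%N)) qd.
  by rewrite subKn // expn1 dvdn1 => /eqP q1; rewrite q1 in q_pr.
have qum : (q%:Z %| u m)%Z.
  exact: dvdz_trans qq (lucas_dvd u0 u1 uSS qS).
(* As q already divides u_m, u_n is even divisible by q^(j+2). *)
rewrite [X in u X]nE jE; apply: dvdz_trans (lucas_dvd_expS u0 u1 uSS j.+1 qum).
by rewrite dvdzE /= dvdn_exp2l.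
Qed.

(** * Constructing many members of L *)

Lemma exp_leq_bin (n k : nat) : (k <= n)%N -> (n ^ k <= 'C(n, k) * k ^ k)%N.
Proof.
elim: k n => [|k IHk] [|n] //; rewrite ltnS => kn.
rewrite [(k.+1 ^ k.+1)%N]expnS mulnA [('C(_, _) * _)%N]mulnC -mul_bin_diag.
rewrite expnS -mulnA leq_mul2l /=.
have [->|k_gt0] := posnP k; first by rewrite bin0.
rewrite -(@leq_pmul2r (k ^ k)) ?expn_gt0 ?k_gt0 // -expnMn.
(* In the form (n+1)/(k+1) <= n/k, this bounds ((n+1)/(k+1))^k by (n/k)^k, to which the induction
   hypothesis applies. *)
have le1 : (n.+1 * k <= n * k.+1)%N by rewrite mulSn mulnS leq_add2r.
apply: (@leq_trans ((n * k.+1) ^ k)); first by rewrite leq_exp2r.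
by rewrite expnMn [leqRHS]mulnAC leq_mul2r IHk ?orbT.
Qed.

(** Encoded over ordinals so that the k-element subsets can be enumerated and counted. *)
Definition smooth_primes (N B : nat) : {set 'I_B.+1} :=
  [set p : 'I_B.+1 |
    prime p && all (fun q => q <= N)%N (primes (p ^ 2 - 1))]%SET.

(** The number M: N! contains every prime up to N, and no prime power dividing a positive number up
    to B^2 has an exponent above log_2 (B^2). *)
Definition smooth_modulus (N B : nat) : nat :=
  (N`! ^ trunc_log 2 (B ^ 2))%N.

Lemma smooth_dvd_modulus (N B m : nat) : (0 < m)%N -> (m <= B ^ 2)%N ->
  all (fun q => q <= N)%N (primes m) -> (m %| smooth_modulus N B)%N.
Proof.
move=> m_gt0 mB /allP mN; apply/dvdn_partP => // q qm.
have := qm; rewrite inE mem_primes => /and3P[q_pr _ _]; rewrite p_part.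
have qN : (q %| N`!)%N by rewrite dvdn_fact // prime_gt0 //= mN.
apply: (@dvdn_trans (q ^ trunc_log 2 (B ^ 2))); last exact: dvdn_exp2r.
apply/dvdn_exp2l/trunc_log_max => //; apply: leq_trans mB.
apply: leq_trans (dvdn_leq m_gt0 (pfactor_dvdnn q m)).
by rewrite leq_exp2r ?prime_gt1 // logn_gt0.
Qed.

(** A prime factor of q - 1 or q + 1 can exceed q only if it equals q + 1; then q = 2 and the factor
    is 3, which is at most N. *)
Lemma prime_sqr_pred_smooth (N q : nat) : (2 < N)%N -> prime q -> (q <= N)%N ->
  all (fun r => r <= N)%N (primes (q ^ 2 - 1)).
Proof.
move=> N2 q_pr qN; apply/allP => r; rewrite mem_primes => /and3P[r_pr q2 rq].
move: q2 rq; rewrite sqrn_sub1 muln_gt0 Euclid_dvdM // => /andP[q1 _] /orP[] rq.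
  by apply: leq_trans (dvdn_leq q1 rq) _; apply: leq_trans (leq_pred _) qN.
have := dvdn_leq (ltn0Sn q) rq.
rewrite leq_eqVlt ltnS => /orP[/eqP rE|/leq_trans-> //].
have [q2|q_odd] := even_prime q_pr; first by rewrite rE q2.
have [-> //|] := even_prime r_pr; first exact: ltnW.
by rewrite rE /= q_odd.
Qed.

Lemma prime_dvd_prod_ord (B q : nat) (S : {set 'I_B.+1}) :
  prime q -> (forall p, p \in S -> prime p) ->
  (q %| \prod_(p in S) p)%N -> exists2 p, p \in S & q = p :> nat.
Proof.
move=> q_pr S_pr; rewrite Euclid_dvd_prod // big_orE => /exists_inP[p pS qp].
by exists p => //; apply/eqP; rewrite -dvdn_prime2 // S_pr.
Qed.

(** The elements of such a set are recovered as the prime divisors of its product. *)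
Lemma prod_primes_inj (B : nat) (S T : {set 'I_B.+1}) :
  (forall p, p \in S -> prime p) -> (forall p, p \in T -> prime p) ->
  (\prod_(p in S) p = \prod_(p in T) p)%N -> S = T.
Proof.
move=> S_pr T_pr E.
have sub (U V : {set 'I_B.+1}) : (forall p, p \in U -> prime p) ->
    (forall p, p \in V -> prime p) ->
    (\prod_(p in U) p = \prod_(p in V) p)%N -> U \subset V.
  move=> U_pr V_pr UV; apply/fintype.subsetP => p pU.
  have : (p %| \prod_(p in V) p)%N by rewrite -UV (bigD1 p) //= dvdn_mulr.
  by case/(prime_dvd_prod_ord (U_pr _ pU) V_pr) => r rV /val_inj ->.
by apply/eqP; rewrite finset.eqEsubset !sub.
Qed.

(** The members are M times the product of a k-subset. A prime q dividing one of them divides M, so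
    that q <= N, or lies in the subset; in both cases q^2 - 1 is N-smooth and below B^2, hence
    divides M. *)
Lemma sqr_pred_closed_family (N B k X : nat) : (2 < N)%N -> (N <= B)%N ->
  (smooth_modulus N B * B ^ k <= X)%N ->
  exists s : seq nat,
    [/\ uniq s, forall n, n \in s -> (n <= X)%N /\ sqr_pred_closed n &
        size s = 'C(#|smooth_primes N B|, k)].
Proof.
move=> N2 NB MX; set P := smooth_primes N B; set M := smooth_modulus N B.
have P_pr (S : {set 'I_B.+1}) : S \subset P -> forall p, p \in S -> prime p.
  by move=> /fintype.subsetP SP p /SP; rewrite inE => /andP[].
have M_gt0 : (0 < M)%N by rewrite expn_gt0 fact_gt0.
exists [seq (M * \prod_(p in (A : {set 'I_B.+1})) p)%N | A <- enum
         [set A : {set 'I_B.+1} | A \subset P & #|A| == k]%SET]; split.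
- rewrite map_inj_in_uniq ?enum_uniq // => S T.
  rewrite !mem_enum !inE => /andP[/P_pr S_pr _] /andP[/P_pr T_pr _] /eqP.
  by rewrite eqn_pmul2l // => /eqP/prod_primes_inj; apply.
- move=> n /mapP[S]; rewrite mem_enum inE => /andP[SP /eqP Sk] {n}->.
  have S_pr := P_pr _ SP; split.
    apply: leq_trans MX; rewrite leq_mul2l; apply/orP; right.
    rewrite -Sk -prod_nat_const; apply: leq_prod => p _.
    by rewrite -ltnS.
  split=> [|q q_pr].
    by rewrite muln_gt0 M_gt0 prodn_cond_gt0 // => p /S_pr/prime_gt0.
  rewrite Euclid_dvdM // => qS; apply: dvdn_mulr.
  have [qB qN] : (q <= B)%N /\ all (fun r => r <= N)%N (primes (q ^ 2 - 1)).
    case/orP: qS => [|/(prime_dvd_prod_ord q_pr S_pr)[p pS ->]].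
      rewrite Euclid_dvdX // => /andP[qN _].
      have {}qN : (q <= N)%N.
        rewrite leqNgt; apply: contraL qN => Nq; rewrite fact_prod.
        rewrite Euclid_dvd_prod // big_has_cond -all_predC; apply/allP => i.
        rewrite mem_index_iota => /andP[i_gt0 iN] /=.
        by rewrite gtnNdvd // (leq_trans iN).
      by split; [apply: leq_trans qN NB | apply: prime_sqr_pred_smooth].
    split; first by rewrite -ltnS.
    by move/fintype.subsetP: SP => /(_ _ pS); rewrite inE => /andP[].
  apply: smooth_dvd_modulus => //.
    by rewrite subn_gt0 -{1}(exp1n 2) ltn_exp2r // prime_gt1.
  by apply: leq_trans (leq_subr _ _) _; rewrite leq_exp2r.
- by rewrite size_map -cardE cards_draws.
Qed.

(** * Counting up to a real bound, and the size of the construction *)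

Lemma counted_finite (R : realType) (A : set nat) (x : R) :
  finite_set (A `&` [set n : nat | (1 <= n)%N /\ n%:R <= x]).
Proof.
apply: sub_finite_set (finite_II (Num.trunc x).+1) => n [_ [_ nx]] /=.
by rewrite ltnS truncn_ge_nat // (le_trans _ nx).
Qed.

Lemma count_upto_ge (R : realType) (A : set nat) (x : R) (s : seq nat) :
  uniq s -> (forall n, n \in s -> [/\ A n, (0 < n)%N & n%:R <= x]) ->
  (size s <= count_upto A x)%N.
Proof.
move=> s_uniq sA; rewrite -[in leqLHS](undup_id s_uniq) -card_fseq.
apply/fsubset_leq_card/fsubsetP => n; rewrite !inE /= => /sA[An n0 nx].
by rewrite in_fset_set ?inE //; exact: counted_finite.
Qed.

Lemma count_upto_le (R : realType) (A : set nat) (x : R) (s : seq nat) :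
  (forall n, A n -> (0 < n)%N -> n%:R <= x -> n \in s) ->
  (count_upto A x <= size s)%N.
Proof.
move=> sA; apply: leq_trans (size_undup s); rewrite -card_fseq.
apply/fsubset_leq_card/fsubsetP => n.
rewrite in_fset_set; last exact: counted_finite.
by rewrite !inE /= => -[An [n0 nx]]; exact: sA.
Qed.

Lemma count_upto_mono (R : realType) (A B : set nat) (x : R) :
  A `<=` B -> (count_upto A x <= count_upto B x)%N.
Proof.
move=> AB; apply: count_upto_le => n /AB Bn n0 nx.
by rewrite in_fset_set ?inE //; exact: counted_finite.
Qed.

(** With y = e^L, use N! <= N^N <= e^(Ly) and log_2 (y^(2v)) = 2vL / ln 2. Thus log M is of order at
    most y (log y)^2. *)
Lemma smooth_modulus_le (R : realType) (v L : R) : 0 <= v -> 0 <= L ->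
  (smooth_modulus (Num.trunc (expR L)) (Num.trunc (expR (L * v))))%:R
    <= expR (2 * v * expR L * L ^+ 2 / ln 2).
Proof.
move=> v0 L0; rewrite /smooth_modulus.
set N := Num.trunc _; set B := Num.trunc _; set E := trunc_log _ _.
have ln2 : 0 < ln 2 :> R by rewrite ln_gt0 // ltr1n.
have NL : N%:R <= expR L by rewrite truncn_le expR_ge0.
have BL : B%:R <= expR (L * v) by rewrite truncn_le expR_ge0.
have B0 : (0 < B)%N.
  by rewrite truncn_gt0 -[leLHS](expR0 R) ler_expR mulr_ge0.
have EL : E%:R <= 2 * v * L / ln 2.
  rewrite ler_pdivlMr // -ler_expR expRM_natl lnK ?posrE //.
  apply: (@le_trans _ _ (B ^ 2)%:R).
    by rewrite -natrX ler_nat trunc_logP // expn_gt0 B0.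
  rewrite natrX (_ : 2 * v * L = 2%:R * (L * v)); last by ring.
  by rewrite expRM_natl lerXn2r // nnegrE ?expR_ge0.
have fact_le : (N`! <= N ^ N)%N.
  rewrite fact_prod -[X in (_ ^ X)%N](card_ord N) -prod_nat_const.
  rewrite big_add1 big_mkord.
  by apply: leq_prod => i _.
have ME : (N`! ^ E)%:R <= N%:R ^+ (N * E) :> R.
  rewrite -natrX ler_nat expnM; case: (posnP E) => [->//|E0].
  by rewrite leq_exp2r.
apply: le_trans ME _.
apply: (@le_trans _ _ (expR L ^+ (N * E))).
  by rewrite lerXn2r // nnegrE ?expR_ge0.
rewrite -expRM_natl ler_expR natrM.
have -> : 2 * v * expR L * L ^+ 2 / ln 2 = expR L * (2 * v * L / ln 2) * L.
  by rewrite expr2; ring.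
by rewrite ler_wpM2r // ler_pM.
Qed.

Lemma Pi_smooth_le (R : realType) (x y : R) :
  (Pi_smooth x y <= #|smooth_primes (Num.trunc y) (Num.trunc x)|)%N.
Proof.
rewrite cardE -(size_map (@nat_of_ord _)); apply: count_upto_le.
move=> p [p_pr py] _ px.
have pB : (p < (Num.trunc x).+1)%N.
  by rewrite ltnS truncn_ge_nat // (le_trans _ px).
apply/mapP; exists (Ordinal pB) => //; rewrite mem_enum inE /= p_pr /=.
apply/allP => q; rewrite mem_primes => /and3P[q_pr _ qp].
by have qy := py q q_pr qp; rewrite truncn_ge_nat // (le_trans _ qy).
Qed.

Lemma bin_ge_expR (R : realType) (n k : nat) (a b : R) : (k <= n)%N ->
  k%:R <= expR a -> expR b <= n%:R -> expR (k%:R * (b - a)) <= ('C(n, k))%:R.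
Proof.
move=> kn ka bn; rewrite mulrBr expRB ler_pdivrMr ?expR_gt0 //.
rewrite !expRM_natl.
apply: (@le_trans _ _ (n%:R ^+ k)).
  by rewrite lerXn2r // nnegrE ?expR_ge0.
apply: (@le_trans _ _ ('C(n, k) * k ^ k)%:R).
  by rewrite -natrX ler_nat exp_leq_bin.
by rewrite natrM natrX ler_wpM2l // lerXn2r // nnegrE ?expR_ge0.
Qed.

(** Here y = e^L and log x = l = y^(1+d). The two last hypotheses say that M takes at most x^d and
    that there are at least y^(v-d) primes to choose from. *)
Lemma count_sqr_pred_closed_ge (R : realType) (v d L : R) :
  1 < v -> 0 < d -> d <= 1 / 2 -> 2 * d <= v - 1 -> 2 <= L ->
  let l := expR (L * (1 + d)) in
  2 * v * expR L * L ^+ 2 <= ln 2 * d * l ->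
  expR (L * (v - d)) <= (Pi_smooth (expR (L * v)) (expR L))%:R ->
  expR ((1 - 1 / v - 4 * d) * l) <= (count_upto sqr_pred_closed (expR l))%:R.
Proof.
move=> v1 d0 d2 dv L2 l Hl HP.
have v0 : 0 < v by lra.
have L0 : 0 < L by lra.
have ln2 : 0 < ln 2 :> R by rewrite ln_gt0 // ltr1n.
have ln2_le1 : ln 2 <= 1 :> R.
  by rewrite (_ : 2 = 1 + 1) ?le_ln1Dx //; lra.
have l0 : 0 < l := expR_gt0 _.
pose P := smooth_primes (Num.trunc (expR L)) (Num.trunc (expR (L * v))).
have {HP} HP : expR (L * (v - d)) <= #|P|%:R.
  by apply: le_trans HP _; rewrite ler_nat Pi_smooth_le.
(* Rounding k down costs at most one factor y^v; this bounds it by x^d. *)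
have vLl : v * L <= d * l.
  rewrite -(ler_pM2l ln2) [leRHS]mulrA; apply: le_trans Hl.
  have e1 : 1 <= expR L by rewrite -[leLHS](expR0 R) ler_expR ltW.
  have vL0 : 0 < v * L by rewrite mulr_gt0.
  have : 1 * 2 <= expR L * L by rewrite ler_pM.
  have -> : 2 * v * expR L * L ^+ 2 = 2 * (v * L) * (expR L * L).
    by rewrite expr2; ring.
  by nra.
(* The largest k with y^(vk) <= x^(1-d), which leaves x^d for M. *)
pose k := Num.trunc ((1 - d) * l / (v * L)).
have kx0 : 0 <= (1 - d) * l / (v * L).
  by rewrite divr_ge0 ?mulr_ge0 ?ltW //; lra.
have /andP[k1 k2] := truncn_itv kx0; rewrite -/k -natr1 in k1 k2.
rewrite ler_pdivlMr ?mulr_gt0 // in k1.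
rewrite ltr_pdivrMr ?mulr_gt0 // in k2.
(* Used twice: l = y^(1+d) is at most y^(v-d), so k primes are available, and it bounds the k^k lost
   in the binomial coefficient. *)
have k_le_l : k%:R <= l.
  have vL1 : 1 <= v * L by nra.
  have k0 : (0 : R) <= k%:R by [].
  by nra.
have kP : (k <= #|P|)%N.
  rewrite -(ler_nat R); apply: le_trans k_le_l _; apply: le_trans HP.
  by rewrite ler_expR ler_pM2l //; lra.
have NB : (Num.trunc (expR L) <= Num.trunc (expR (L * v)))%N.
  by rewrite le_truncn // ler_expR; nra.
have N3 : (2 < Num.trunc (expR L))%N.
  rewrite truncn_gt_nat; apply: le_trans (expR_ge1Dx L).
  by rewrite -natr1; lra.
have MX : (smooth_modulus (Num.trunc (expR L)) (Num.trunc (expR (L * v))) *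
           Num.trunc (expR (L * v)) ^ k <= Num.trunc (expR l))%N.
  rewrite truncn_ge_nat ?expR_ge0 // natrM natrX.
  apply: (@le_trans _ _ (expR (d * l) * expR (k%:R * (L * v)))); last first.
    by rewrite -expRD ler_expR; lra.
  apply: ler_pM => //.
    apply: le_trans (smooth_modulus_le (ltW v0) (ltW L0)) _.
    by rewrite ler_expR ler_pdivrMr //; lra.
  by rewrite expRM_natl lerXn2r ?nnegrE ?expR_ge0 // truncn_le expR_ge0.
have [s [s_uniq sL s_size]] := sqr_pred_closed_family N3 NB MX.
apply: (@le_trans _ _ ('C(#|P|, k))%:R); last first.
  rewrite -s_size ler_nat; apply: count_upto_ge s_uniq _ => n /sL[nX nL].
  split=> //; first by case: nL.
  by rewrite -truncn_ge_nat ?expR_ge0.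
apply: le_trans (bin_ge_expR kP k_le_l HP); rewrite ler_expR.
have -> : L * (v - d) - L * (1 + d) = L * (v - 1 - 2 * d) by ring.
have kL : (1 - 2 * d) * l <= k%:R * L * v by nra.
rewrite -(ler_pM2r v0) (_ : _ * v = (v - 1 - 4 * d * v) * l); last first.
  by field; lra.
(* The product (1 - 2d)(v - 1 - 2d) is v - 1 - 2dv + 4d^2, which exceeds v - 1 - 4dv. *)
apply: (@le_trans _ _ ((1 - 2 * d) * l * (v - 1 - 2 * d))); last first.
  rewrite (_ : k%:R * (L * (v - 1 - 2 * d)) * v =
               k%:R * L * v * (v - 1 - 2 * d)); last by ring.
  by rewrite ler_wpM2r //; lra.
by nra.
Qed.

(** * Letting the parameters tend to infinity *)

Lemma ge_power_o1I (R : realType) (F : R -> nat) (c : R) :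
  (forall e : R, 0 < e -> \forall x \near +oo, x `^ (c - e) <= (F x)%:R) ->
  ge_power_o1 F c.
Proof.
(* The exact exponent of F(x) minus c, capped at 0: the power bound is then automatic, and [H] keeps
   it above -e for large x. *)
move=> H; exists (fun x => Num.min 0 (ln (F x)%:R / ln x - c)).
(* From [H] with e = 1; it makes ln F(x) a genuine logarithm. *)
have Fpos : \forall x \near +oo, (1 < x) /\ (0 < F x)%N.
  near=> x; have x1 : 1 < x by near: x; apply: nbhs_pinfty_gt; rewrite num_real.
  split=> //; rewrite -(ltr0n R); apply: (@lt_le_trans _ _ (x `^ (c - 1))).
    by rewrite powR_gt0 // (lt_trans _ x1).
  by near: x; exact: H.
split.
  apply/cvgrPdist_le => e e0; near=> x.
  have [x1 Fx] : (1 < x) /\ (0 < F x)%N by near: x.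
  have He : x `^ (c - e) <= (F x)%:R by near: x; exact: H.
  have lx : 0 < ln x by rewrite ln_gt0.
  have : c - e <= ln (F x)%:R / ln x.
    rewrite ler_pdivlMr // -ln_powR ler_ln // posrE ?ltr0n //.
    by rewrite powR_gt0 // (lt_trans _ x1).
  rewrite sub0r normrN ler_norml; move: (_ / _) => r cer.
  by apply/andP; split; [rewrite le_min; lra | rewrite ge_min; lra].
near=> x.
have [x1 Fx] : (1 < x) /\ (0 < F x)%N by near: x.
have lx : 0 < ln x by rewrite ln_gt0.
have x0 : 0 < x by rewrite (lt_trans _ x1).
apply: (@le_trans _ _ (x `^ (ln (F x)%:R / ln x))).
  by apply: ler_powR; [exact: ltW | rewrite -lerBrDl ge_min lexx orbT].
by rewrite -{1}(lnK x0) -expRM mulrC divfK ?gt_eqF // lnK ?posrE ?ltr0n.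
Unshelve. all: by end_near. Qed.

(** Use e^t >= 1 + t^3/6 at t = Ld. This turns the bound y (log y)^2 for log M into a small multiple
    of y^(1+d). *)
Lemma expR_dominates_sqr (R : realType) (C d : R) : 0 < C -> 0 < d ->
  exists L0 : R, forall L, L0 < L -> L ^+ 2 <= C * expR (L * d).
Proof.
move=> C0 d0; exists (6 / (C * d ^+ 3)) => L HL.
have Cd0 : 0 < C * d ^+ 3 by rewrite mulr_gt0 // exprn_gt0.
have L0 : 0 < L by apply: lt_trans HL; rewrite divr_gt0.
have := expR_ge1Dxn 2 (mulr_ge0 (ltW L0) (ltW d0)).
move=> H; rewrite mulrC -ler_pdivrMr //; apply: le_trans H.
rewrite ler_wpDl // ler_pdivrMr // (_ : 3`!%:R = 6 :> R) //.
rewrite (_ : _ * C = L ^+ 2 * (L * (C * d ^+ 3) / 6)); last by field.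
move: HL; rewrite ltr_pdivrMr // => HL.
by rewrite ler_peMr ?sqr_ge0 // ler_pdivlMr // mul1r ltW.
Qed.

Lemma count_sqr_pred_closed_ge_power (R : realType) (v : R) : 1 < v ->
  ge_power_o1 (fun y : R => Pi_smooth (y `^ v) y) v ->
  ge_power_o1 (fun x : R => count_upto sqr_pred_closed x) (1 - 1 / v).
Proof.
move=> v1 [eps [eps0 HP]]; apply: ge_power_o1I => e e0.
(* The first and last bounds are demanded by [count_sqr_pred_closed_ge]; e / 4 absorbs its loss 4d
   in the exponent. *)
pose d := Num.min (1 / 2) (Num.min (e / 4) ((v - 1) / 2)).
have [d0 d12 d4 dv] : [/\ 0 < d, d <= 1 / 2, d <= e / 4 & d <= (v - 1) / 2].
  by split; rewrite /d ?lt_min ?ge_min ?lexx ?orbT //; lra.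
clearbody d.
have [M [_ HM]] : \forall y \near +oo,
    y `^ (v - d) <= (Pi_smooth (y `^ v) y)%:R.
  near=> y.
  have y1 : 1 <= y by near: y; apply: nbhs_pinfty_ge; rewrite num_real.
  have epsy : `|0 - eps y| <= d.
    by near: y; move/cvgrPdist_le: eps0; apply.
  apply: (@le_trans _ _ (y `^ (v + eps y))); last by near: y.
  apply: ler_powR => //; move: epsy; rewrite sub0r normrN ler_norml.
  by case/andP => *; lra.
have ln2 : 0 < ln 2 :> R by rewrite ln_gt0 // ltr1n.
have C0 : 0 < ln 2 * d / (2 * v) by rewrite divr_gt0 ?mulr_gt0 //; lra.
have [L0 HL0] := expR_dominates_sqr C0 d0.
(* Beyond [L1], the bound on log M holds and y = e^L exceeds the threshold [M] for [Pi_smooth]; the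
   inner maximum keeps the argument of [ln] positive. *)
pose L1 := Num.max 2 (Num.max L0 (ln (Num.max 1 M))).
exists (expR (expR (L1 * (1 + d)))); split; first exact: num_real.
move=> x Hx.
have x0 : 0 < x := lt_trans (expR_gt0 _) Hx.
have lx0 : expR (L1 * (1 + d)) < ln x.
  by rewrite -ltr_expR lnK.
have lx1 : 0 < ln x := lt_trans (expR_gt0 _) lx0.
(* Solves log x = y^(1+d) for L = log y. *)
pose L := ln (ln x) / (1 + d).
have LE : expR (L * (1 + d)) = ln x by rewrite divfK ?lnK //; lra.
have L1L : L1 < L.
  by move: lx0; rewrite -LE ltr_expR ltr_pM2r //; lra.
move: L1L; rewrite !gt_max => /and3P[L2 /HL0 LC LM].
have LM' : M < expR L.
  apply: (@le_lt_trans _ _ (Num.max 1 M)); first by rewrite le_max lexx orbT.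
  by rewrite -ltr_expR lnK // posrE lt_max ltr01 in LM.
have := @count_sqr_pred_closed_ge R v d L v1 d0 d12 _ (ltW L2).
rewrite /= LE lnK // => H.
rewrite -{1}(lnK x0) -expRM mulrC.
apply: (le_trans _ (H _ _ _)); first 1 last.
- by lra.
(* Multiply [LC] by 2v e^L; its constant ln 2 * d / (2v) was chosen for this. *)
- rewrite -LE mulrDr mulr1 expRD.
  have eL : 0 < expR L := expR_gt0 _.
  have v20 : 0 < 2 * v by lra.
  move: LC; rewrite -(ler_pM2l (mulr_gt0 v20 eL)) => /le_trans; apply.
  by rewrite le_eqVlt; apply/orP; left; apply/eqP; field; lra.
- by have := HM _ LM'; rewrite -!expRM.
by rewrite ler_expR; nra.
Unshelve. all: by end_near. Qed.

Theorem theorem3 (R : realType) :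
  (exists L : set nat,
     [/\ L `<=` [set n : nat | (0 < n)%N],
         (forall (a1 a2 : int) (u : nat -> int),
            a2 = 1 \/ a2 = -1 -> lucas_sequence a1 a2 u ->
            L `<=` self_divisors u) &
         (forall v : R, 1 < v ->
            ge_power_o1 (fun y : R => Pi_smooth (y `^ v) y) v ->
            ge_power_o1 (fun x : R => count_upto L x) (1 - 1 / v))]) /\
  (forall v : R, 1 < v ->
     ge_power_o1 (fun y : R => Pi_smooth (y `^ v) y) v ->
     forall (a1 a2 : int) (u : nat -> int),
       a2 = 1 \/ a2 = -1 -> lucas_sequence a1 a2 u ->
       ge_power_o1 (fun x : R => count_upto (self_divisors u) x) (1 - 1 / v)).
Proof.
(* This inclusion is property (i), and by monotonicity of counting it carries the lower bound for L
   over to every sequence. *)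
have sub (a1 a2 : int) (u : nat -> int) :
    a2 = 1 \/ a2 = -1 -> lucas_sequence a1 a2 u ->
    sqr_pred_closed `<=` self_divisors u.
  move=> a2E [u0 u1 uSS _] n nL; split; first by case: nL.
  exact: sqr_pred_closed_lucas u0 u1 uSS a2E nL.
split.
  exists sqr_pred_closed; split=> [n []//|//|v].
  exact: count_sqr_pred_closed_ge_power.
move=> v v1 HP a1 a2 u a2E uL.
have [eps [eps0 Heps]] := count_sqr_pred_closed_ge_power v1 HP.
exists eps; split=> //; apply: filterS Heps => x /le_trans; apply.
by rewrite ler_nat; apply/count_upto_mono/(sub _ _ _ a2E uL).
Qed.
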